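(* Consider a parameterized family of zero-sum stage games and a learning strategy for player 1 that plays the same stage-game strategy every round until some learning event. Call a sequence of rounds between learning events, throughout which the same stage-game strategy is played, an epoch, and number the epochs $i=1,2,\ldots$. For each $i$ let $c_i\ge 0$ be a given real number. Suppose that the following two facts hold for any game in the family: (1) For any epoch $i$'s stage-game strategy $\sigma_1^i$ for player 1, any stage-game strategy $\sigma_2$ for player 2 will either with nonzero probability cause the learning event that changes the epoch to $i+1$, or will not give player 2 any advantage, i.e. player 1's expected loss from the round when player 2 plays $\sigma_2$ is at most $0$. (2) For any of those strategies $\sigma_2$ that with nonzero probability cause the learning event that changes the epoch to $i+1$, $$\frac{\lambda(\sigma_1^i,\sigma_2)}{p^i(\sigma_1^i,\sigma_2)}\le c_i ,$$ where $\lambda(\sigma_1^i,\sigma_2)$ is the expected one-round loss to player 1 and $p^i(\sigma_1^i,\sigma_2)$ is the probability of this round causing the learning event that changes the epoch to $i+1$. Then, with this learning strategy, the family of games is BL-WoLF-learnable with loss $\sum_i c_i$; that is, for any game in the family, against any opponent, and for any integer $N\ge 0$, player 1's expected cumulative loss over the first $N$ rounds when using this learning strategy is at most $\sum_i c_i$.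
   Context: Stage game. There are two players, player 1 (the learner) and player 2 (the opponent), with action sets $A_1, A_2$. Each pair of actions determines a pair of utilities (deterministic payoffs) or a probability distribution over pairs of utilities (stochastic payoffs); the game is zero-sum (the utilities sum to a constant). A stage-game strategy for player $i$ is a probability distribution over $A_i$. The value $V$ of the game is $V=\max_{\sigma_1}\min_{\sigma_2}E[u_1\mid\sigma_1,\sigma_2]$; all stage games are assumed to have a value (as is automatic for finite action sets). Repeated game. A parameterized family of stage games consists of fixed action sets $A_1,A_2$, a parameter set $K$, and a map sending each $k\in K$ to a zero-sum stage game with these action sets. One $k \in K$ is fixed, and the corresponding stage game is played over and over (random payoffs being drawn independently each round). Player 2 knows $k$ and player 1's learning strategy; player 1 knows only the family. After each round player 1 observes both actions and the payoffs. A learning strategy for player 1 prescribes a stage-game strategy for each history of past actions and payoffs; the opponent may likewise use any history-dependent strategy. Player 1's loss in a round is $V$ (the value of the actual stage game) minus the utility player 1 received in that round; the loss incurred over several rounds is the sum of the losses of those rounds. BL-WoLF-learnability. A family is BL-WoLF-learnable with loss $l$ if there exists a learning strategy for player 1 such that, for any game in the family, against any opponent, and for any integer $N\ge 0$, player 1's expected cumulative loss over the first $N$ rounds is at most $l$. Learning events. A learning event is an event, occurring at the end of a round and determined by what player 1 has observed, upon which the learning strategy moves from epoch $i$ to epoch $i+1$ (possibly changing its stage-game strategy). As the notation $p^i(\sigma_1^i,\sigma_2)$ indicates, within an epoch the probability that a round causes the learning event is determined by the stage-game strategies used in that round. The two facts are required for every stage-game strategy $\sigma_1^i$ that the learning strategy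 may use in epoch $i$. *)

(* Defs.v *)
From HB Require Import structures.
From mathcomp Require Import all_boot all_order all_algebra.
From mathcomp Require Import all_classical all_reals all_analysis.
From mathcomp Require Import measurable_realfun.

Set Implicit Arguments.
Unset Strict Implicit.
Unset Printing Implicit Defensive.

Import Order.TTheory GRing.Theory Num.Theory.
Import numFieldNormedType.Exports.

Local Open Scope classical_set_scope.
Local Open Scope ring_scope.

(* The joint law of (x, y) when x is drawn from P and then y from k x. *)
Section semidirect.
Context {d d'} {X : measurableType d} {Y : measurableType d'} {R : realType}.
Variables (P : probability X R) (k : {mfun X >-> pprobability Y R}).

Let kk : R.-pker X ~> Y := kprobability (measurable_funPT k).

Definition semidirect (B : set (X * Y)) : \bar R :=
  (\int[P]_x k x (xsection B x))%E.

Let msection (B : set (X * Y)) : measurable B ->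
  measurable_fun [set: X] (fun x => k x (xsection B x) : \bar R).
Proof.
move=> mB; have := @measurable_fun_xsection_finite_kernel _ _ X Y R kk B.
by apply; rewrite inE.
Qed.

Let semidirect0 : semidirect set0 = 0%E.
Proof.
rewrite /semidirect integral0_eq// => x _.
by rewrite (_ : xsection _ _ = set0) ?measure0// xsection0.
Qed.

Let semidirect_ge0 B : (0 <= semidirect B)%E.
Proof. by apply: integral_ge0 => x _; exact: measure_ge0. Qed.

Let semidirect_sigma_additive : semi_sigma_additive semidirect.
Proof.
move=> F mF tF mUF; rewrite /semidirect.
rewrite [X in _ --> X](_ : _ =
    (\sum_(0 <= n <oo) semidirect (F n))%E); last first.
  rewrite /semidirect -integral_nneseries//; last by move=> n; exact: msection.
  apply: eq_integral => x _; rewrite xsection_bigcup.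
  apply: measure_semi_bigcup => //.
  - by move=> n; exact: measurable_xsection.
  - exact: trivIset_xsection.
  - by apply: bigcup_measurable => n _; exact: measurable_xsection.
by apply: is_cvg_nneseries => n _ _; exact: semidirect_ge0.
Qed.

HB.instance Definition _ := isMeasure.Build _ _ _ semidirect
  semidirect0 semidirect_ge0 semidirect_sigma_additive.

Let semidirect_setT : semidirect [set: X * Y] = 1%E.
Proof.
rewrite /semidirect (eq_integral (fun=> 1%E)) => [|x _].
  rewrite integral_cst// mul1e; exact: probability_setT.
rewrite (_ : xsection _ _ = [set: Y]); first exact: probability_setT.
by apply/seteqP; split => y // _; rewrite /xsection/= inE.
Qed.

HB.instance Definition _ :=
  Measure_isProbability.Build _ _ _ semidirect semidirect_setT.

End semidirect.

Section product_kernel.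
Context {d d1 d2} {X : measurableType d} {Y : measurableType d1}
  {Z : measurableType d2} {R : realType}.
Variables (f : {mfun X >-> pprobability Y R})
  (g : {mfun X >-> pprobability Z R}).

Definition product_kernel (x : X) : {measure set (Y * Z) -> \bar R} :=
  (f x \x g x)%E.

Let measurable_product_kernel (B : set (Y * Z)) : measurable B ->
  measurable_fun [set: X] (product_kernel ^~ B).
Proof.
move=> mB; rewrite /product_kernel /product_measure1.
have mg1 : measurable_fun [set: X * Y] (g \o fst : _ -> pprobability Z R).
  exact: measurableT_comp.
pose kf : R.-pker X ~> Y := kprobability (measurable_funPT f).
pose kg : R.-pker (X * Y) ~> Z := kprobability mg1.
pose B' := (fun xyz : X * Y * Z => (xyz.1.2, xyz.2)) @^-1` B.
have mB' : measurable B'.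
  rewrite -[B']setTI; apply: (_ : measurable_fun setT _) => //.
  apply/measurable_fun_pairP; split; last exact: measurable_snd.
  exact: (measurableT_comp measurable_snd measurable_fst).
have B'E xy : xsection B' xy = xsection B xy.2.
  by apply/seteqP; split => z; rewrite /xsection/= !inE.
pose k (xy : X * Y) := kg xy (xsection B xy.2).
suff mk : measurable_fun [set: X * Y] k.
  apply: (measurable_fun_integral_finite_kernel k kf _ mk) => xy.
  exact: measure_ge0.
rewrite (_ : k = fun xy => kg xy (xsection B' xy)); last first.
  by apply/funext => xy; rewrite B'E.
have := @measurable_fun_xsection_finite_kernel _ _ _ _ R kg B'.
by apply; rewrite inE.
Qed.

HB.instance Definition _ := isKernel.Build _ _ _ _ R product_kernel
  measurable_product_kernel.

Let product_kernel_setT x : product_kernel x [set: Y * Z] = 1%E.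
Proof. exact: (@probability_setT _ _ _ (f x \x g x)%E). Qed.

HB.instance Definition _ := Kernel_isProbability.Build _ _ _ _ R product_kernel
  product_kernel_setT.

End product_kernel.

(* Strategies and random payoffs have type [pprobability T R], the measurable
   space of probability measures on T. Action sets carry a sigma-algebra (the
   discrete one for finite or countable action sets), and a deterministic payoff
   is a Dirac measure. The players randomize independently in each round. *)
Section stage_game.
Context {d1 d2} {A1 : measurableType d1} {A2 : measurableType d2}
  {R : realType}.

Local Notation round := (A1 * A2 * (R * R))%type.

(* The outcome (a1, a2, (u1, u2)) of a round is what player 1 observes. *)
Definition utility1 (o : round) : R := o.2.1.

Local Notation payoffs := {mfun (A1 * A2)%type >-> pprobability (R * R)%type R}.

Definition round_law (g : payoffs) (s1 : pprobability A1 R)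
    (s2 : pprobability A2 R) : probability round R :=
  semidirect (s1 \x s2)%E g.

Definition expected_utility (g : payoffs) s1 s2 : R :=
  \int[round_law g s1 s2]_o utility1 o.

Definition is_min (S : set R) (m : R) := S m /\ lbound S m.
Definition is_max (S : set R) (m : R) := S m /\ ubound S m.

(* V = max_{s1} min_{s2} E[u1 | s1, s2], where [worst s1] is the inner minimum. *)
Definition is_value (g : payoffs) (V : R) :=
  exists2 worst : pprobability A1 R -> R,
    forall s1, is_min (range (expected_utility g s1)) (worst s1) &
    is_max (range worst) V.

End stage_game.

(* The expectations E[u1 | s1, s2] in the definition of the value
   are required to exist: otherwise [expected_utility] is a junk value. *)
Record zero_sum_game {d1 d2} (A1 : measurableType d1) (A2 : measurableType d2)
    (R : realType) := ZeroSumGame {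
  payoff :> {mfun (A1 * A2)%type >-> pprobability (R * R)%type R};
  zero_sum : exists c : R, forall a, {ae payoff a, forall u, u.1 + u.2 = c};
  integrable_utility1 : forall s1 s2,
    (round_law payoff s1 s2).-integrable setT (EFin \o utility1);
  value : R;
  valueP : is_value payoff value }.

Section one_round_loss.
Context {d1 d2} {A1 : measurableType d1} {A2 : measurableType d2}
  {R : realType}.

Definition loss (g : zero_sum_game A1 A2 R) (o : A1 * A2 * (R * R)) : R :=
  value g - utility1 o.

Definition expected_loss (g : zero_sum_game A1 A2 R) s1 s2 : R :=
  \int[round_law g s1 s2]_o loss g o.

End one_round_loss.

Section play.
Context {d1 d2} {A1 : measurableType d1} {A2 : measurableType d2}
  {R : realType}.

Local Notation round := (A1 * A2 * (R * R))%type.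
Local Notation history n := (n.-tuple round).

Definition strategy1 := forall n, {mfun history n >-> pprobability A1 R}.
Definition strategy2 := forall n, {mfun history n >-> pprobability A2 R}.

Section next_round.
Variables (g : zero_sum_game A1 A2 R) (L : strategy1) (T : strategy2) (n : nat).

Definition next_round (h : history n) : pprobability round R :=
  round_law g (L n h) (T n h).

Let measurable_next_round_set (B : set round) : measurable B ->
  measurable_fun [set: history n] (fun h => next_round h B : \bar R).
Proof.
move=> mB.
pose l : R.-pker history n ~> (A1 * A2)%type := product_kernel (L n) (T n).
pose kg : R.-pker (A1 * A2)%type ~> (R * R)%type :=
  kprobability (measurable_funPT g).
pose f (a : A1 * A2) := kg a (xsection B a).
suff mf : measurable_fun [set: A1 * A2] f.
  apply: (measurable_fun_integral_finite_kernel
    (f \o snd : history n * (A1 * A2) -> \bar R) l) => [ha|].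
    exact: measure_ge0.
  exact: (measurableT_comp mf measurable_snd).
have := @measurable_fun_xsection_finite_kernel _ _ _ _ R kg B.
by apply; rewrite inE.
Qed.

Lemma measurable_next_round : measurable_fun [set: history n] next_round.
Proof.
apply: (measurability (@pset _ _ _ : set (set (pprobability round R)))) => //.
move=> _ -[_ [r r01] [B mB <-]] <-.
apply: emeasurable_fun_infty_o => //.
exact: measurable_next_round_set.
Qed.

HB.instance Definition _ :=
  @isMeasurableFun.Build _ _ _ _ next_round measurable_next_round.

End next_round.

(* Histories are listed chronologically. *)
Definition extend n (ho : history n * round) : history n.+1 :=
  rcons_tuple ho.1 ho.2.

Lemma measurable_extend n : measurable_fun [set: history n * round] (@extend n).
Proof.
apply/measurable_fun_tnthP => i.
have [lt_in|le_ni] := ltnP i n.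
  rewrite (_ : _ \o _ = (fun h => tnth h (Ordinal lt_in)) \o fst).
    by apply: measurableT_comp => //; exact: measurable_tnth.
  apply/funext => -[h o] /=.
  by rewrite !(tnth_nth o)/= nth_rcons size_tuple lt_in.
rewrite (_ : _ \o _ = snd) //; apply/funext => -[h o] /=.
have /eqP ein : nat_of_ord i == n by rewrite eqn_leq -ltnS ltn_ord.
by rewrite (tnth_nth o)/= nth_rcons size_tuple ein ltnn eqxx.
Qed.

HB.instance Definition _ n :=
  @isMeasurableFun.Build _ _ _ _ (@extend n) (@measurable_extend n).

(* The law of the first n rounds; given a history, both players draw their
   actions independently and the payoffs are drawn from the stage game. *)
Fixpoint play_law (g : zero_sum_game A1 A2 R) (L : strategy1) (T : strategy2)
    (n : nat) : probability (history n) R :=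
  match n with
  | 0 => \d_([tuple] : history 0)
  | m.+1 => distribution
              (semidirect (play_law g L T m) (@next_round g L T m)) (@extend m)
  end.

Definition cumulative_loss (g : zero_sum_game A1 A2 R) N (h : history N) : R :=
  \sum_(t < N) loss g (tnth h t).

(* The loss bound l is extended real, so that an infinite sum is allowed; the
   integrability required of the games makes the cumulative loss integrable. *)
Definition BL_WoLF_guarantee (K : Type) (G : K -> zero_sum_game A1 A2 R)
    (L : strategy1) (l : \bar R) :=
  forall (k : K) (T : strategy2) (N : nat),
    ('E_(play_law (G k) L T N)[@cumulative_loss (G k) N] <= l)%E.

Definition BL_WoLF_learnable (K : Type) (G : K -> zero_sum_game A1 A2 R)
    (l : \bar R) :=
  exists L : strategy1, BL_WoLF_guarantee G L l.

End play.

Arguments strategy1 {d1 d2} A1 A2 R.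
Arguments strategy2 {d1 d2} A1 A2 R.

(* [epoch h] is the number of the epoch to which the round following h belongs.
   A learning event occurs at the end of that round when extending h by its
   outcome increments the epoch. *)
Record epoch_strategy {d1 d2} (A1 : measurableType d1) (A2 : measurableType d2)
    (R : realType) := EpochStrategy {
  play :> strategy1 A1 A2 R;
  epoch : forall n, {mfun n.-tuple (A1 * A2 * (R * R))%type >-> nat};
  epoch_start : epoch 0 [tuple] = 1%N;
  epoch_step : forall n (h : n.-tuple (A1 * A2 * (R * R))%type) o,
    epoch n.+1 (extend (h, o)) = epoch n h \/
    epoch n.+1 (extend (h, o)) = (epoch n h).+1;
  epoch_constant : forall n (h : n.-tuple (A1 * A2 * (R * R))%type) o,
    epoch n.+1 (extend (h, o)) = epoch n h ->
    play n.+1 (extend (h, o)) = play n h }.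

Section learning_events.
Context {d1 d2} {A1 : measurableType d1} {A2 : measurableType d2}
  {R : realType} {K : Type}.
Variables (G : K -> zero_sum_game A1 A2 R) (L : epoch_strategy A1 A2 R).

(* [used k i] contains the stage-game strategies that L may use in epoch i when
   the game is k: against every opponent, the history reached after n rounds
   almost surely prescribes one of them. Histories that are impossible in the
   game k are thereby ignored. *)
Definition may_use (used : K -> nat -> set (pprobability A1 R)) :=
  forall (k : K) (T : strategy2 A1 A2 R) (n : nat),
    {ae play_law (G k) L T n,
      forall h, used k (epoch L n h) (play L n h)}.

(* [p k i s1 s2] is the probability, in the game k, that a round of epoch i in
   which s1 and s2 are played causes the learning event ending epoch i; it does
   not depend otherwise on the history reached. *)
Definition learning_event_probability
    (p : K -> nat -> pprobability A1 R -> pprobability A2 R -> R) :=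
  forall (k : K) (T : strategy2 A1 A2 R) (n : nat),
    {ae play_law (G k) L T n,
      forall h, forall s2 : pprobability A2 R,
        round_law (G k) (play L n h) s2
          [set o | epoch L n.+1 (extend (h, o)) = (epoch L n h).+1]
        = (p k (epoch L n h) (play L n h) s2)%:E}.

End learning_events.

(* Main.v *)
(** Let an epoch i release the budget c i when it ends. In a round of epoch i,
    the expected loss is at most c i times the probability that the round ends
    the epoch, which is the expected budget released by the round. Hence the
    cumulative loss minus the released budget is a supermartingale starting
    from 0, and the released budget never exceeds the sum of all the c i. *)

From HB Require Import structures.
Require Import Defs.
From mathcomp Require Import all_boot all_order all_algebra.
From mathcomp Require Import all_classical all_reals all_analysis.
From mathcomp Require Import measurable_realfun.

Set Implicit Arguments.
Unset Strict Implicit.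
Unset Printing Implicit Defensive.

Import Order.TTheory GRing.Theory Num.Theory.
Import numFieldNormedType.Exports.

Local Open Scope classical_set_scope.
Local Open Scope ring_scope.

(** * Integration against semidirect products *)

Lemma integral_probability_cst {d} {X : measurableType d} {R : realType}
    (P : probability X R) (r : \bar R) : (\int[P]_x r = r)%E.
Proof.
rewrite integral_cst// [X in (_ * X)%E](_ : _ = 1%E) ?mule1//.
exact: probability_setT.
Qed.

(** The sigma-algebra on [pprobability X R] is generated by evaluations at measurable sets, and
    evaluating [\d_x] at [B] gives the indicator of [B]. *)
Lemma measurable_dirac_pprobability {d} {X : measurableType d} {R : realType} :
  measurable_fun [set: X] (fun x => \d_x : pprobability X R).
Proof.
apply: (measurability (@pset _ _ _ : set (set (pprobability X R)))) => //.
move=> _ -[_ [r r01] [B mB <-]] <-.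
apply: emeasurable_fun_infty_o => //.
by apply/measurable_EFinP.
Qed.

Section integral_semidirect.
Context {d d'} {X : measurableType d} {Y : measurableType d'} {R : realType}.
Variables (P : probability X R) (k : {mfun X >-> pprobability Y R}).

(* [ge0_integral_semidirect] is derived from [integral_kcomp] by writing the
   semidirect product as the composition of P with the kernel
   x |-> \d_x \x k x; composition requires a parameter, here in [unit]. *)
Let dirac_snd : {mfun (unit * X)%type >-> pprobability X R} :=
  HB.pack (fun ux : unit * X => \d_(ux.2) : pprobability X R)
    (isMeasurableFun.Build _ _ _ _ _
      (measurableT_comp measurable_dirac_pprobability measurable_snd)).

Let k_snd : {mfun (unit * X)%type >-> pprobability Y R} :=
  HB.pack (fun ux : unit * X => k ux.2)
    (isMeasurableFun.Build _ _ _ _ _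
      (measurableT_comp (measurable_funPT k) measurable_snd)).

Lemma ge0_integral_semidirect (f : X * Y -> \bar R) :
    (forall z, 0 <= f z)%E -> measurable_fun setT f ->
  (\int[semidirect P k]_z f z = \int[P]_x \int[k x]_y f (x, y))%E.
Proof.
move=> f0 mf.
pose l : R.-pker unit ~> X :=
  kprobability (measurable_cst (P : pprobability X R)).
pose q : R.-pker (unit * X)%type ~> (X * Y)%type :=
  product_kernel dirac_snd k_snd.
transitivity (\int[kcomp l q tt]_z f z)%E.
  apply: eq_measure_integral => B mB _.
  rewrite /= /kcomp /semidirect; apply: eq_integral => x _.
  rewrite /q /= /product_measure1 integral_dirac// ?diracT ?mul1e//.
  exact: measurable_fun_xsection.
rewrite integral_kcomp//; apply: eq_integral => x _.
rewrite /q /= fubini_tonelli1// /fubini_F integral_dirac// ?diracT ?mul1e//.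
exact: measurable_fun_fubini_tonelli_F.
Qed.

End integral_semidirect.

Section integrability_semidirect.
Context {d d'} {X : measurableType d} {Y : measurableType d'} {R : realType}.
Variables (P : probability X R) (k : {mfun X >-> pprobability Y R}).

Lemma measurable_integral_kernel (f : X * Y -> \bar R) :
    (forall z, 0 <= f z)%E -> measurable_fun setT f ->
  measurable_fun setT (fun x => \int[k x]_y f (x, y))%E.
Proof.
move=> f0 mf.
pose q : R.-pker X ~> Y := kprobability (measurable_funPT k).
exact: (measurable_fun_integral_finite_kernel f q f0 mf).
Qed.

(** Tonelli turns a bound on the inner integrals that is uniform in [x] into the same bound on the
    whole integral, as [P] has mass 1. *)
Lemma integrable_semidirect (f : X * Y -> \bar R) (M : R) :
    measurable_fun setT f ->
    (forall x, \int[k x]_y `|f (x, y)| <= M%:E)%E ->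
  (semidirect P k).-integrable setT f.
Proof.
move=> mf fM; apply/integrableP; split => //.
rewrite ge0_integral_semidirect//; last exact: measurableT_comp.
apply: (@le_lt_trans _ _ (\int[P]_x (M%:E))%E); last first.
  by rewrite integral_probability_cst ltry.
apply: ge0_le_integral => //.
- by move=> x _; exact: integral_ge0.
- apply: (measurable_integral_kernel (f := abse \o f)) => //.
    by move=> z /=.
  exact: measurableT_comp.
Qed.

(** Tonelli applies to the positive and negative parts separately; hypothesis and conclusion both
    become comparisons of these two parts. *)
Lemma integral_semidirect_le0 (f : X * Y -> \bar R) :
    measurable_fun setT f ->
    {ae P, forall x, (\int[k x]_y f (x, y) <= 0)%E} ->
  (\int[semidirect P k]_z f z <= 0)%E.
Proof.
move=> mf f_le0.
have mp := measurable_funepos mf; have mn := measurable_funeneg mf.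
rewrite integralE sube_le0.
rewrite !ge0_integral_semidirect//.
apply: ae_ge0_le_integral => //.
- by move=> x _; exact: integral_ge0.
- exact: (measurable_integral_kernel _ mp).
- by move=> x _; exact: integral_ge0.
- exact: (measurable_integral_kernel _ mn).
apply: filterS f_le0 => x + _.
rewrite integralE sube_le0.
by rewrite !unlock.
Qed.

End integrability_semidirect.

(** * Boundedness from finite integrals against all products of strategies *)

Lemma le_integral_atom {d} {X : measurableType d} {R : realType}
    (mu : {measure set X -> \bar R}) (h : X -> \bar R) (x : X) :
    measurable [set x] -> (forall y, 0 <= h y)%E -> measurable_fun setT h ->
  (h x * mu [set x] <= \int[mu]_y h y)%E.
Proof.
move=> mx h0 mh; rewrite -integral_cst//.
rewrite (eq_integral h) => [|y]; last by rewrite inE => ->.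
exact: ge0_subset_integral.
Qed.

(* If f (a n) grows fast enough along a sequence a, then f has infinite integral
   against the product of two strategies that charge the two coordinates of
   every a n. *)
Lemma bounded_of_finite_product_integrals {d1 d2} {A1 : measurableType d1}
    {A2 : measurableType d2} {R : realType} (f : A1 * A2 -> \bar R) :
    (forall a, 0 <= f a)%E -> measurable_fun setT f ->
    (forall (s1 : pprobability A1 R) (s2 : pprobability A2 R),
      \int[(s1 \x s2)%E]_a f a < +oo)%E ->
  exists M : R, forall a, (f a <= M%:E)%E.
Proof.
move=> f0 mf fi; apply: contrapT => /forallNP unbounded.
(* All that is used of the Poisson law is that every integer has positive mass. *)
pose mu : probability nat R := poisson_prob 1 0%N.
pose w n : R := poisson_pmf 1 n.
have muE n : mu [set n] = (w n)%:E.
  rewrite /mu /= /poisson_prob ltr01 esum_set1//.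
  by rewrite lee_fin poisson_pmf_ge0.
have w0 n : 0 < w n.
  rewrite /w /poisson_pmf ltr01 expr1n mul1r.
  by rewrite mulr_gt0 ?expR_gt0 ?invr_gt0 ?ltr0n ?fact_gt0.
(* The threshold is divided by [w n] twice because the point [a n] gets weighted by [w n] once for
   each coordinate. *)
have /choice[a fa] n : exists a, ((n%:R / w n / w n)%:E < f a)%E.
  have /existsNP[a /negP] := unbounded (n%:R / w n / w n).
  by rewrite -ltNge; exists a.
have ma1 : measurable_fun [set: nat] (fst \o a) by [].
have ma2 : measurable_fun [set: nat] (snd \o a) by [].
pose X1 : {RV mu >-> A1} :=
  HB.pack (fst \o a) (isMeasurableFun.Build _ _ _ _ _ ma1).
pose X2 : {RV mu >-> A2} :=
  HB.pack (snd \o a) (isMeasurableFun.Build _ _ _ _ _ ma2).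
have := fi (distribution mu X1) (distribution mu X2).
rewrite fubini_tonelli1// ge0_integral_distribution; last 2 first.
- exact: measurable_fun_fubini_tonelli_F.
- by move=> x; exact: integral_ge0.
set I := (\int[_]_x _)%E => I_fin.
(* Restricting first the outer and then the inner integral to the atom [n] leaves
   [f (a n) * w n * w n], which is at least [n]. *)
have I_ge n : (n%:R%:E <= I)%E.
  pose h := fubini_F (distribution mu X2) f \o X1.
  have : (h n * mu [set n] <= I)%E.
    apply: le_integral_atom => //.
    by move=> i; exact: integral_ge0.
  apply: le_trans; rewrite {}/h muE /= /fubini_F.
  rewrite ge0_integral_distribution//; last first.
    exact: measurableT_comp.
  have : (f (a n) * mu [set n] <= \int[mu]_j f ((a n).1, (a j).2))%E.
    rewrite [in leLHS](surjective_pairing (a n)).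
    by apply: (@le_integral_atom _ _ _ mu (fun j => f ((a n).1, (a j).2))).
  rewrite muE => /(lee_wpmul2r _) => /(_ (w n)%:E) H.
  apply: le_trans (H _); last by rewrite lee_fin ltW.
  rewrite (_ : n%:R = n%:R / w n / w n * w n * w n); last first.
    by rewrite !divfK// gt_eqF.
  by rewrite 2!EFinM !lee_wpmul2r// ?lee_fin; exact/ltW.
have I_fin_num : I \is a fin_num.
  by rewrite ge0_fin_numE//; exact: le_trans (I_ge 0%N).
have := I_ge (Num.truncn (fine I)).+1.
by rewrite -(fineK I_fin_num) lee_fin leNgt truncnS_gt.
Qed.

(** * The first marginal of a semidirect product *)

Section semidirect_fst.
Context {d d'} {X : measurableType d} {Y : measurableType d'} {R : realType}.
Variables (P : probability X R) (k : {mfun X >-> pprobability Y R}).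

Lemma ge0_integral_semidirect_fst (f : X -> \bar R) :
    (forall x, 0 <= f x)%E -> measurable_fun setT f ->
  (\int[semidirect P k]_z f z.1 = \int[P]_x f x)%E.
Proof.
move=> f0 mf; rewrite ge0_integral_semidirect//; last first.
  exact: measurableT_comp.
apply: eq_integral => x _ /=; exact: integral_probability_cst.
Qed.

Lemma integral_semidirect_fst (f : X -> \bar R) : measurable_fun setT f ->
  (\int[semidirect P k]_z f z.1 = \int[P]_x f x)%E.
Proof.
move=> mf; rewrite integralE [RHS]integralE.
rewrite -[in RHS]ge0_integral_semidirect_fst//; last exact: measurable_funepos.
rewrite -[in RHS]ge0_integral_semidirect_fst//; last exact: measurable_funeneg.
by rewrite !unlock.
Qed.

Lemma integrable_semidirect_fst (f : X -> \bar R) : P.-integrable setT f ->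
  (semidirect P k).-integrable setT (f \o fst).
Proof.
move=> /integrableP[mf fi]; apply/integrableP; split.
  exact: measurableT_comp.
rewrite (ge0_integral_semidirect_fst (f := fun x => `|f x|%E))//.
exact: measurableT_comp.
Qed.

End semidirect_fst.

(** * The loss of a single round *)

Section one_round.
Context {d1 d2} {A1 : measurableType d1} {A2 : measurableType d2}
  {R : realType} (g : zero_sum_game A1 A2 R).

Lemma measurable_utility1 :
  measurable_fun setT (@utility1 _ _ A1 A2 R).
Proof. by apply: (measurableT_comp measurable_fst). Qed.

Lemma measurable_loss : measurable_fun setT (loss g).
Proof. by apply: measurable_funB => //; exact: measurable_utility1. Qed.

Lemma integrable_loss s1 s2 :
  (round_law g s1 s2).-integrable setT (EFin \o loss g).
Proof.
rewrite (_ : _ \o _ =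
    (fun=> (value g)%:E) \- (EFin \o @utility1 _ _ A1 A2 R))%E.
  apply: integrableB => //; last exact: integrable_utility1.
  exact: finite_measure_integrable_cst.
by apply/funext => o; rewrite /= /loss EFinB.
Qed.

(** Integrability rules out the default value that the real integral takes at infinity. *)
Lemma expected_loss_EFin s1 s2 :
  ((expected_loss g s1 s2)%:E = \int[round_law g s1 s2]_o (loss g o)%:E)%E.
Proof. by rewrite fineK// integrable_fin_num//; exact: integrable_loss. Qed.

(* Against an opponent whose play depends on the history, the actions of a round
   are correlated, so that integrability must come from a bound that is uniform
   over the strategies. *)
Lemma absolute_loss_bounded :
  exists M : R, forall s1 s2,
    (\int[round_law g s1 s2]_o `|(loss g o)%:E| <= M%:E)%E.
Proof.
have m_loss : measurable_fun setT (fun o => `|(loss g o)%:E|%E).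
  apply/measurableT_comp => //; apply/measurable_EFinP.
  exact: measurable_loss.
(* [f a] is the mean absolute loss given the actions [a]; its integral is finite under every product
   of strategies, hence [f] is bounded. *)
pose f a := (\int[payoff g a]_u `|(loss g (a, u))%:E|)%E.
have mf : measurable_fun setT f.
  exact: (measurable_integral_kernel (payoff g) _ m_loss).
have fE (s1 : pprobability A1 R) (s2 : pprobability A2 R) :
    (\int[round_law g s1 s2]_o `|(loss g o)%:E| = \int[(s1 \x s2)%E]_a f a)%E.
  by rewrite /round_law ge0_integral_semidirect.
have f0 a : (0 <= f a)%E by exact: integral_ge0.
have [|M fM] := bounded_of_finite_product_integrals f0 mf.
  by move=> s1 s2; rewrite -fE; have /integrableP[] := integrable_loss s1 s2.
exists M => s1 s2; rewrite fE.
apply: (@le_trans _ _ (\int[(s1 \x s2)%E]_a M%:E)%E).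
  exact: ge0_le_integral.
by rewrite (integral_probability_cst (s1 \x s2)%E).
Qed.

End one_round.

(** * Histories, epochs and the released budget *)

Lemma extend_surj {d1 d2} {A1 : measurableType d1} {A2 : measurableType d2}
    {R : realType} n (h : n.+1.-tuple (A1 * A2 * (R * R))%type) :
  exists h' o, h = extend (h', o).
Proof.
case: h => s; case/lastP: s => [|s o] // sz.
have sn : size s == n by rewrite size_rcons eqSS in sz.
by exists (Tuple sn), o; exact: val_inj.
Qed.

Section drift.
Context {d1 d2} {A1 : measurableType d1} {A2 : measurableType d2}
  {R : realType}.
Variables (g : zero_sum_game A1 A2 R) (L : epoch_strategy A1 A2 R)
  (T : strategy2 A1 A2 R) (c : nat -> R).

Local Notation round := (A1 * A2 * (R * R))%type.
Local Notation history n := (n.-tuple round).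
Local Notation P n := (play_law g L T n).
Local Notation next n := (@next_round _ _ A1 A2 R g L T n).

(** The epoch starts at 1 and rises by at most one per round. The upper bound is what caps the
    budget after [n] rounds. *)
Lemma epoch_bounds n (h : history n) : (1 <= epoch L n h <= n.+1)%N.
Proof.
elim: n h => [h|n IHn h]; first by rewrite tuple0 epoch_start.
have [h' [r ->]] := extend_surj h; have /andP[e1 en] := IHn h'.
by case: (epoch_step L h' r) => ->; rewrite ?e1 ?ltnS ?en ?(leq_trans en).
Qed.

Definition learning_event n (h : history n) : set round :=
  [set o | epoch L n.+1 (extend (h, o)) = (epoch L n h).+1].

(* The part of the loss budget [\sum_i c i] released by the epochs completed so
   far. *)
Definition budget n (h : history n) : R := \sum_(1 <= i < epoch L n h) c i.

Definition excess n (h : history n) : R := cumulative_loss g h - budget h.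

Lemma cumulative_loss_extend n (h : history n) o :
  cumulative_loss g (extend (h, o)) = cumulative_loss g h + loss g o.
Proof.
rewrite /cumulative_loss big_ord_recr /=; congr (_ + loss g _).
  apply: eq_bigr => i _; congr (loss g _).
  by rewrite !(tnth_nth o) /= nth_rcons size_tuple ltn_ord.
by rewrite (tnth_nth o) /= nth_rcons size_tuple ltnn eqxx.
Qed.

(** Ending epoch [i] appends the single term [c i]; in indicator form, its conditional expectation
    is [c i] times a probability. *)
Lemma budget_extend n (h : history n) o :
  budget (extend (h, o)) = budget h + c (epoch L n h) * \1_(learning_event h) o.
Proof.
rewrite /budget indicE; have /andP[e1 _] := epoch_bounds h.
case: (epoch_step L h o) => E.
  (* If the epoch is unchanged, [o] lies outside the event, since no integer equals its
     successor. *)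
  rewrite memNset ?mulr0 ?addr0 ?E// /learning_event /= E.
  by move/eqP; rewrite -[X in X == _]addn0 -addn1 eqn_add2l.
by rewrite mem_set// mulr1 E big_nat_recr.
Qed.

Lemma measurable_learning_event n (h : history n) :
  measurable (learning_event h).
Proof.
have mE : measurable_fun setT (fun o => epoch L n.+1 (extend (h, o))).
  apply: (measurableT_comp (measurable_funPT (epoch L n.+1))).
  apply: (measurableT_comp (@measurable_extend _ _ A1 A2 R n)).
  exact: measurable_pair1.
by rewrite -[learning_event h]setTI; exact: (mE _ [set _]).
Qed.

(** * Measurability and integrability along the play *)

Lemma measurable_cumulative_loss n :
  measurable_fun setT (@cumulative_loss _ _ A1 A2 R g n).
Proof.
apply: measurable_sum => i.
by apply: (measurableT_comp (measurable_loss g)); exact: measurable_tnth.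
Qed.

Lemma measurable_budget n : measurable_fun setT (@budget n).
Proof.
exact: (measurableT_comp (f := fun e => \sum_(1 <= i < e) c i) _
  (measurable_funPT (epoch L n))).
Qed.

Lemma measurable_excess n : measurable_fun setT (@excess n).
Proof.
apply: measurable_funB; first exact: measurable_cumulative_loss.
exact: measurable_budget.
Qed.

(** Change of variables: [P n.+1] is the image of the semidirect product under [extend]. *)
Lemma integrable_play_lawS n (f : history n.+1 -> \bar R) :
    measurable_fun setT f ->
  (P n.+1).-integrable setT f <->
  (semidirect (P n) (next n)).-integrable setT (fun z => f (extend z)).
Proof.
move=> mf; have mext := @measurable_extend _ _ A1 A2 R n.
have absE : (\int[P n.+1]_h `|f h| =
    \int[semidirect (P n) (next n)]_z `|f (extend z)|)%E.
  by rewrite /= ge0_integral_distribution//; exact: measurableT_comp.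
split=> /integrableP[_ fi]; apply/integrableP; split => //.
- exact: measurableT_comp.
- by rewrite -absE.
- by rewrite absE.
Qed.

Lemma integral_play_lawS n (f : history n.+1 -> \bar R) :
    measurable_fun setT f ->
    (P n.+1).-integrable setT f ->
  (\int[P n.+1]_h f h = \int[semidirect (P n) (next n)]_z f (extend z))%E.
Proof.
move=> mf /(integrable_play_lawS mf) fi.
by rewrite /= integral_distribution.
Qed.

Lemma integrable_cumulative_loss n :
  (P n).-integrable setT (EFin \o @cumulative_loss _ _ A1 A2 R g n).
Proof.
elim: n => [|n IHn].
  rewrite (_ : _ \o _ = EFin \o cst 0).
    exact: finite_measure_integrable_cst.
  by apply/funext => h; rewrite /= /cumulative_loss big_ord0.
apply/integrable_play_lawS.
  by apply/measurable_EFinP; exact: measurable_cumulative_loss.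
rewrite (_ : (fun _ => _) = ((EFin \o cumulative_loss g (N := n)) \o fst) \+
    (fun z => (loss g z.2)%:E))%E; last first.
  by apply/funext => -[h o]; rewrite /= cumulative_loss_extend EFinD.
apply: integrableD => //; first exact: integrable_semidirect_fst.
have [M lossM] := absolute_loss_bounded g.
apply: (@integrable_semidirect _ _ _ _ _ _ _ _ M) => [|h]; last exact: lossM.
apply/measurable_EFinP; apply: (measurableT_comp (measurable_loss g)).
exact: measurable_snd.
Qed.

Lemma integrable_budget n : (forall i, (1 <= i)%N -> 0 <= c i) ->
  (P n).-integrable setT (EFin \o @budget n).
Proof.
move=> c_ge0; apply: measurable_bounded_integrable => //.
- exact: le_lt_trans (probability_le1 _ _) (ltry 1).
- exact: measurable_budget.
(* After [n] rounds at most [n] epochs are over, so this partial sum dominates the budget. *)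
exists (\sum_(1 <= i < n.+1) c i); split; first exact: num_real.
move=> M /ltW M_ge h _; apply: le_trans M_ge.
have /andP[e1 en] := epoch_bounds h.
rewrite ger0_norm; last first.
  by rewrite /budget big_nat_cond; apply: sumr_ge0 => i /andP[/andP[/c_ge0]].
rewrite /budget (big_cat_nat e1 en) /= lerDl big_nat_cond.
apply: sumr_ge0 => i /andP[/andP[ei _] _].
exact/c_ge0/(leq_trans e1).
Qed.

Lemma integrable_excess n : (forall i, (1 <= i)%N -> 0 <= c i) ->
  (P n).-integrable setT (EFin \o @excess n).
Proof.
move=> c_ge0.
rewrite (_ : _ \o _ = (EFin \o @cumulative_loss _ _ A1 A2 R g n) \-
    (EFin \o @budget n))%E; last first.
  by apply/funext => h; rewrite /= /excess EFinB.
apply: integrableB => //; first exact: integrable_cumulative_loss.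
exact: integrable_budget.
Qed.

(** * The supermartingale property of the excess *)

(** In the increment of the excess the past cancels, leaving the loss of the round minus the budget
    released on the learning event. *)
Lemma integral_drift n (h : history n) (q : R) :
    next n h (learning_event h) = q%:E ->
  (\int[next n h]_o (excess (extend (h, o)) - excess h)%:E =
   (expected_loss g (play L n h) (T n h) - c (epoch L n h) * q)%:E)%E.
Proof.
move=> hq.
have indic_int : (next n h).-integrable setT
    (fun o => (\1_(learning_event h) o)%:E).
  by apply: integrable_indic; exact: measurable_learning_event.
under eq_integral => o _.
  rewrite /excess cumulative_loss_extend budget_extend.
  rewrite [X in X%:E](_ : _ = loss g o -
    c (epoch L n h) * \1_(learning_event h) o); last first.
    by rewrite [- (budget h + _)]opprD addrACA [X in X - _]addrC addrK.
  rewrite EFinB EFinM.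
  over.
rewrite integralB//=; last 2 first.
- exact: integrable_loss.
- exact: integrableZl.
rewrite integralZl// integral_indic//; last exact: measurable_learning_event.
by rewrite setIT EFinB EFinM expected_loss_EFin -hq.
Qed.

(** Induction on [n]: the new excess is the old one plus its increment. The old one is handled by
    the first marginal and the induction hypothesis, the increment by conditioning on the
    history. *)
Lemma integral_excess_le0 n : (forall i, (1 <= i)%N -> 0 <= c i) ->
    (forall m, {ae P m, forall h,
      (\int[next m h]_o (excess (extend (h, o)) - excess h)%:E <= 0)%E}) ->
  (\int[P n]_h (excess h)%:E <= 0)%E.
Proof.
move=> c_ge0 drift_le0; elim: n => [|n IHn].
  (* Before the first round nothing is lost, and epoch 1 makes the budget sum empty. *)
  rewrite integral0_eq// => h _.
  rewrite /excess /cumulative_loss /budget big_ord0 tuple0 epoch_start.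
  by rewrite big_geq ?subrr.
have m_excess : measurable_fun setT (EFin \o @excess n.+1).
  by apply/measurable_EFinP; exact: measurable_excess.
have excess_play := integrable_excess n.+1 c_ge0.
have excessS_int : (semidirect (P n) (next n)).-integrable setT
    (fun z => (excess (extend z))%:E).
  exact: (iffLR (integrable_play_lawS m_excess)).
rewrite (@integral_play_lawS _ (EFin \o @excess n.+1))//.
have excess_int : (semidirect (P n) (next n)).-integrable setT
    (fun z => (excess z.1)%:E).
  exact: (integrable_semidirect_fst _ (integrable_excess n c_ge0)).
have drift_int : (semidirect (P n) (next n)).-integrable setT
    (fun z => (excess (extend z) - excess z.1)%:E).
  by under eq_fun do rewrite EFinB; exact: integrableB.
rewrite (eq_integral (fun z => (excess z.1)%:E +
    (excess (extend z) - excess z.1)%:E)%E) => [|z _]; last first.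
  by rewrite -EFinD addrC subrK.
rewrite integralD//; apply: adde_le0.
  rewrite (integral_semidirect_fst _ _ (f := EFin \o @excess n))//.
  by apply/measurable_EFinP; exact: measurable_excess.
apply: integral_semidirect_le0; first by have /integrableP[] := drift_int.
exact: drift_le0.
Qed.

End drift.

(** * From the two facts to the loss guarantee *)

Theorem lemma1 (R : realType) (d1 d2 : measure_display)
    (A1 : measurableType d1) (A2 : measurableType d2)
    (K : Type) (G : K -> zero_sum_game A1 A2 R)
    (L : epoch_strategy A1 A2 R)
    (c : nat -> R) (c_ge0 : forall i : nat, (1 <= i)%N -> 0 <= c i)
    (used : K -> nat -> set (pprobability A1 R))
    (used_L : may_use G L used)
    (p : K -> nat -> pprobability A1 R -> pprobability A2 R -> R)
    (p_L : learning_event_probability G L p)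
    (fact1 : forall (k : K) (i : nat) (s1 : pprobability A1 R)
        (s2 : pprobability A2 R), (1 <= i)%N -> used k i s1 ->
      p k i s1 s2 != 0 \/ expected_loss (G k) s1 s2 <= 0)
    (fact2 : forall (k : K) (i : nat) (s1 : pprobability A1 R)
        (s2 : pprobability A2 R), (1 <= i)%N -> used k i s1 ->
      p k i s1 s2 != 0 ->
      expected_loss (G k) s1 s2 / p k i s1 s2 <= c i) :
  BL_WoLF_guarantee G L (\sum_(1 <= i <oo) (c i)%:E)%E /\
  BL_WoLF_learnable G (\sum_(1 <= i <oo) (c i)%:E)%E.
Proof.
suff guarantee : BL_WoLF_guarantee G L (\sum_(1 <= i <oo) (c i)%:E)%E.
  by split => //; exists L.
move=> k T N; rewrite unlock.
have c_ge0E i : (1 <= i)%N -> (0 <= (c i)%:E)%E.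
  by move=> /c_ge0; rewrite lee_fin.
have drift_le0 m : {ae play_law (G k) L T m, forall h,
    (\int[next_round (G k) L T h]_o
      (excess (G k) L c (extend (h, o)) - excess (G k) L c h)%:E <= 0)%E}.
  (* The exceptional null set of [p_L] does not depend on [s2], so [p_L] can be instantiated at the
     history-dependent [T m h]. *)
  apply: filterS2 (used_L k T m) (p_L k T m) => h used_h p_h.
  have /andP[e1 _] := epoch_bounds L h.
  rewrite (integral_drift c (p_h (T m h))) lee_fin subr_le0.
  have p_ge0 : 0 <= p k (epoch L m h) (play L m h) (T m h).
    by rewrite -lee_fin -p_h measure_ge0.
  (* Where [p] vanishes, [fact1] leaves only a nonpositive expected loss; elsewhere [p] is positive
     and [fact2] is multiplied by it. *)
  have [p0|p_neq0] := eqVneq (p k (epoch L m h) (play L m h) (T m h)) 0.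
    have [|] := fact1 k _ _ (T m h) e1 used_h; first by rewrite p0 eqxx.
    by rewrite p0 mulr0.
  have := fact2 k _ _ (T m h) e1 used_h p_neq0.
  by rewrite ler_pdivrMr// lt_def p_neq0.
(* The budget is a partial sum of a series of nonnegative terms, whose limit may be infinite. *)
have budget_le (h : N.-tuple (A1 * A2 * (R * R))%type) :
    ((budget L c h)%:E <= \sum_(1 <= i <oo) (c i)%:E)%E.
  rewrite /budget -sumEFin; apply: nneseries_lim_ge => i i1 _.
  exact: c_ge0E.
(* The loss splits into the excess, whose mean is nonpositive, and the budget, bounded pointwise by
   the series. *)
rewrite (eq_integral (fun h =>
    (excess (G k) L c h)%:E + (budget L c h)%:E)%E) => [|h _]; last first.
  by rewrite -EFinD /excess subrK.
rewrite integralD//; last 2 first.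
- exact: integrable_excess.
- exact: integrable_budget.
apply: (@le_trans _ _ (\int[play_law (G k) L T N]_h (budget L c h)%:E)%E).
  by rewrite -[leRHS]add0e leeD2r// integral_excess_le0.
apply: (@le_trans _ _
    (\int[play_law (G k) L T N]_h (\sum_(1 <= i <oo) (c i)%:E))%E).
  apply: ge0_le_integral => //.
  - move=> h _; rewrite lee_fin /budget big_nat_cond.
    by apply: sumr_ge0 => i /andP[/andP[/c_ge0]].
  - by apply/measurable_EFinP; exact: measurable_budget.
by rewrite integral_probability_cst.
Qed.
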